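(* Let $S>0$, $\beta>0$, $\omega>0$ and $\alpha\in[0,3/2]$. Then the initial-value problem $$u''+\frac{\beta}{\sqrt{\omega}}\,u'+\sqrt{2u}=1,\qquad u(0)=\tfrac12\alpha^2,\quad u'(0)=0,$$ has a unique solution $u\in C^2([0,S])$. When $\alpha=0$ the solution $u$ is strictly positive on $(0,S]$, and when $\alpha\in(0,3/2]$ the solution is strictly positive on $[0,S]$. Furthermore, $u(s)<9/8$ for all $s\in[0,S]$ and all $\alpha\in[0,3/2)$, and $u(s)\le 9/8$ for all $s\in[0,S]$ and all $\alpha\in[0,3/2]$. Finally, the solution depends continuously on the initial data in the maximum norm: for all $S>0$, $\beta>0$, $\omega>0$, if $u_\alpha$ denotes the unique solution corresponding to $\alpha\in[0,3/2]$, then for every $\alpha_0\in[0,3/2]$ one has $\max_{s\in[0,S]}|u_\alpha(s)-u_{\alpha_0}(s)|\to 0$ as $\alpha\to\alpha_0$ with $\alpha\in[0,3/2]$. That is, for all $S>0$ and all $\alpha\in[0,3/2]$ the initial-value problem is well-posed in the sense of Hadamard on $[0,S]$.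
   Context: A solution on $[0,S]$ is a real-valued nonnegative function $u\in C^2([0,S])$ (one-sided derivatives at the endpoints; nonnegativity is needed for $\sqrt{2u}$ to be defined) satisfying the differential equation for all $s\in[0,S]$ together with the initial conditions; the prime denotes differentiation with respect to $s$. Well-posedness in the sense of Hadamard means existence, uniqueness, and continuous dependence of the solution on the initial data, the latter measured in the norm of $C([0,S])$. The equation is obtained from the dimensionless Washburn equation $\omega(HH')'+\beta HH'+H=1$, $H(0)=\alpha$, $H'(0)=0$, through $u(s)=\frac12 H(T)^2$, $s=T/\sqrt{\omega}$. *)

(* Defs.v *)
From Stdlib Require Import Reals.
Open Scope R_scope.

Definition interval (a b : R) : R -> Prop := fun x => a <= x <= b.

(* [D_in] and [continue_in] only look at points of [interval 0 S], so that at
   0 and S these are the one-sided derivatives and one-sided continuity; values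
   of [u] outside [0, S] are irrelevant. *)
Definition C2_with_derivatives (S : R) (u u' u'' : R -> R) : Prop :=
  forall s : R, interval 0 S s ->
    D_in u u' (interval 0 S) s /\
    D_in u' u'' (interval 0 S) s /\
    continue_in u'' (interval 0 S) s.

Definition is_solution (S beta omega alpha : R) (u : R -> R) : Prop :=
  exists u' u'' : R -> R,
    C2_with_derivatives S u u' u'' /\
    (forall s : R, interval 0 S s -> 0 <= u s) /\
    (forall s : R, interval 0 S s ->
       u'' s + beta / sqrt omega * u' s + sqrt (2 * u s) = 1) /\
    u 0 = / 2 * alpha ^ 2 /\
    u' 0 = 0.

(* A function on [0, S] is represented by any extension to R, hence uniqueness
   is equality on [0, S]. *)
Definition is_unique_solution (S beta omega alpha : R) (u : R -> R) : Prop :=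
  is_solution S beta omega alpha u /\
  forall v : R -> R, is_solution S beta omega alpha v ->
    forall s : R, interval 0 S s -> v s = u s.

Definition is_max_norm (S : R) (f : R -> R) (m : R) : Prop :=
  (exists s : R, interval 0 S s /\ Rabs (f s) = m) /\
  (forall s : R, interval 0 S s -> Rabs (f s) <= m).

Definition continuous_in_data_at
    (S : R) (u : R -> R -> R) (alpha0 : R) : Prop :=
  exists d : R -> R,
    (forall alpha : R, interval 0 (3 / 2) alpha ->
       is_max_norm S (fun s => u alpha s - u alpha0 s) (d alpha)) /\
    limit1_in d (interval 0 (3 / 2)) 0 alpha0.

(* Continuous dependence at [alpha0] involves the solutions for nearby data, so
   the whole family of solutions is quantified here. *)
Definition hadamard_well_posed (S beta omega alpha0 : R) : Prop :=
  exists u : R -> R -> R,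
    (forall alpha : R, interval 0 (3 / 2) alpha ->
       is_unique_solution S beta omega alpha (u alpha)) /\
    continuous_in_data_at S u alpha0.

(* Main.v *)
Require Import Defs.
From Stdlib Require Import Reals Lra Lia ClassicalEpsilon.
From Coquelicot Require Import Coquelicot.
Open Scope R_scope.

(** Write [c = beta / sqrt omega], [v = u'] and [a = alpha^2 / 2].

    Energy. The function [E = v^2 / 2 + (2 u)^(3/2) / 3 - u] satisfies
    [E' = - c v^2], and by the Cauchy-Schwarz inequality the energy lost up to
    time [t <= S] is at least [(c / S) (u t - a)^2] ([energy_dissipation]). Since
    the initial energy is nonpositive for [alpha <= 3/2], this single inequality
    gives [u <= 9/8], with strict inequality when [alpha < 3/2], and the lower
    bound [u >= min (a / 2) (c a^2 / (4 S))]. For [alpha] close to [0] it is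
    combined with the quadratic growth of [u] while [u <= 1/8]; the outcome is
    [sqrt (2 u) >= k (alpha + s)] on [0, S] with [k > 0] independent of [alpha]
    ([uniform_lower_bound]).

    Uniqueness and continuous dependence. For two solutions with difference [w],
    [|sqrt (2 u1) - sqrt (2 u2)| <= 2 |w| / (k (alpha1 + alpha2 + 2 s))], which
    is singular at [s = 0] when the data vanish. But [|w s|] is at most
    [|alpha1 - alpha2| (alpha1 + alpha2) / 2] plus [s] times a bound on [|w'|],
    so the singularity cancels and a Gronwall argument for [w'] gives
    [|w| <= C |alpha1 - alpha2|] with [C] uniform in the data
    ([lipschitz_dependence]).

    Existence. For [alpha > 0] the square root is cut off below a small level
    [m > 0]; the resulting Lipschitz problem is solved by Picard iteration, and
    the energy argument shows that its solution stays above [m], so that the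
    cut-off is never active. For [alpha = 0] the solution is the uniform limit of
    the solutions with [alpha = 1 / (n + 1)], which form a Cauchy sequence by the
    Lipschitz estimate ([solution_exists]). *)

(** * Differential inequalities on [0, S] *)

Lemma nonincreasing_of_derive (S : R) (f df : R -> R) :
  (forall s, 0 <= s <= S -> is_derive f s (df s)) ->
  (forall s, 0 <= s <= S -> df s <= 0) ->
  forall s t, 0 <= s <= t -> t <= S -> f t <= f s.
Proof.
  intros Hd Hneg s t Hst HtS.
  destruct (MVT_gen f s t df) as [z [Hz Heq]].
  - intros x Hx. rewrite Rmin_left, Rmax_right in Hx by lra. apply Hd; lra.
  - intros x Hx. rewrite Rmin_left, Rmax_right in Hx by lra.
    apply continuity_pt_filterlim, (ex_derive_continuous f x).
    exists (df x); apply Hd; lra.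
  - rewrite Rmin_left, Rmax_right in Hz by lra.
    assert (df z <= 0) by (apply Hneg; lra). nra.
Qed.

Lemma abs_le_of_derive (S : R) (p dp q dq : R -> R) :
  (forall s, 0 <= s <= S -> is_derive p s (dp s)) ->
  (forall s, 0 <= s <= S -> is_derive q s (dq s)) ->
  (forall s, 0 <= s <= S -> Rabs (dp s) <= dq s) ->
  Rabs (p 0) <= q 0 ->
  forall s, 0 <= s <= S -> Rabs (p s) <= q s.
Proof.
  intros Hp Hq Hle H0 s Hs.
  apply Rabs_le_between in H0.
  assert (H1 : p s - q s <= p 0 - q 0).
  { apply (nonincreasing_of_derive S (fun x => p x - q x)
             (fun x => dp x - dq x)); try lra.
    - intros x Hx. apply (is_derive_minus p q); auto.
    - intros x Hx. specialize (Hle x Hx). apply Rabs_le_between in Hle. lra. }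
  assert (H2 : - p s - q s <= - p 0 - q 0).
  { apply (nonincreasing_of_derive S (fun x => - p x - q x)
             (fun x => - dp x - dq x)); try lra.
    - intros x Hx. apply (is_derive_minus (fun x => - p x) q); auto.
      apply (is_derive_opp p); auto.
    - intros x Hx. specialize (Hle x Hx). apply Rabs_le_between in Hle. lra. }
  apply Rabs_le_between. lra.
Qed.

(** Damping only helps: in [p' + c p = g] with [c >= 0] the term [c p] can be
    ignored when [p] is bounded in terms of a bound on [g]. *)
Lemma damped_abs_le (c S : R) (p g q dq : R -> R) :
  0 <= c ->
  (forall s, 0 <= s <= S -> is_derive p s (g s - c * p s)) ->
  (forall s, 0 <= s <= S -> is_derive q s (dq s)) ->
  (forall s, 0 <= s <= S -> Rabs (g s) <= dq s) ->
  (forall s, 0 <= s <= S -> 0 <= q s) ->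
  Rabs (p 0) <= q 0 ->
  forall s, 0 <= s <= S -> Rabs (p s) <= q s.
Proof.
  intros Hc Hp Hq Hle Hpos H0 s Hs.
  assert (Hexp : Rabs (exp (c * s) * p s) <= exp (c * s) * q s).
  { apply (abs_le_of_derive S (fun x => exp (c * x) * p x)
             (fun x => exp (c * x) * g x) (fun x => exp (c * x) * q x)
             (fun x => exp (c * x) * (dq x + c * q x))); auto.
    - intros x Hx. auto_derive.
      + exists (g x - c * p x); apply (Hp x Hx).
      + replace (Derive (fun y => p y) x) with (g x - c * p x)
          by (symmetry; apply is_derive_unique, (Hp x Hx)).
        ring.
    - intros x Hx. auto_derive.
      + exists (dq x); apply (Hq x Hx).
      + replace (Derive (fun y => q y) x) with (dq x)
          by (symmetry; apply is_derive_unique, (Hq x Hx)).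
        ring.
    - intros x Hx. rewrite Rabs_mult, (Rabs_pos_eq (exp _)).
      + apply Rmult_le_compat_l; [left; apply exp_pos|].
        specialize (Hle x Hx). specialize (Hpos x Hx). nra.
      + left; apply exp_pos.
    - rewrite Rmult_0_r, exp_0, !Rmult_1_l; auto. }
  rewrite Rabs_mult, (Rabs_pos_eq (exp _)) in Hexp by (left; apply exp_pos).
  apply Rmult_le_reg_l with (2 := Hexp). apply exp_pos.
Qed.

(** * The truncated square root and its primitive *)

(** [root_cut m x] is the nonlinearity [sqrt (2 x)] with its argument cut off
    below [m]. For [m > 0] it is Lipschitz; for [m = 0] it agrees with
    [sqrt (2 x)] at nonnegative arguments. *)
Definition root_cut (m x : R) : R := sqrt (2 * Rmax x m).

(** A primitive of [root_cut m]; it is affine on the left of [m]. *)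
Definition root_cut_primitive (m x : R) : R :=
  root_cut m x ^ 3 / 3 + root_cut m m * (x - Rmax x m).

Lemma root_cut_ge0 (m x : R) : 0 <= root_cut m x.
Proof. apply sqrt_pos. Qed.

Lemma root_cut_sqr (m x : R) : 0 <= m -> root_cut m x ^ 2 = 2 * Rmax x m.
Proof.
  intros Hm. unfold root_cut. rewrite pow2_sqrt; auto.
  pose proof (Rmax_r x m). lra.
Qed.

Lemma root_cut_incr (m x y : R) : x <= y -> root_cut m x <= root_cut m y.
Proof.
  intros H. apply sqrt_le_1_alt. pose proof (Rle_max_compat_r x y m H). lra.
Qed.

Lemma root_cut_below (m x : R) : x <= m -> root_cut m x = root_cut m m.
Proof. intros H. unfold root_cut. rewrite !Rmax_right by lra. reflexivity. Qed.

Lemma Rmax_contracting (x y m : R) : Rabs (Rmax x m - Rmax y m) <= Rabs (x - y).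
Proof.
  unfold Rmax, Rabs; repeat destruct Rle_dec; repeat destruct Rcase_abs; lra.
Qed.

(** Difference of squares; the source of all Lipschitz estimates. *)
Lemma root_cut_diff_mult (m x y : R) : 0 <= m ->
  Rabs (root_cut m x - root_cut m y) * (root_cut m x + root_cut m y)
    <= 2 * Rabs (x - y).
Proof.
  intros Hm. pose proof (root_cut_sqr m x Hm) as Hx.
  pose proof (root_cut_sqr m y Hm) as Hy.
  pose proof (root_cut_ge0 m x). pose proof (root_cut_ge0 m y).
  pose proof (Rmax_contracting x y m).
  rewrite <- (Rabs_pos_eq (root_cut m x + root_cut m y)) by lra.
  rewrite <- Rabs_mult.
  replace ((root_cut m x - root_cut m y) * (root_cut m x + root_cut m y))
    with (2 * (Rmax x m - Rmax y m)) by nra.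
  rewrite Rabs_mult, (Rabs_pos_eq 2) by lra. lra.
Qed.

Lemma root_cut_holder (m x y : R) : 0 <= m ->
  Rabs (root_cut m x - root_cut m y) <= sqrt (2 * Rabs (x - y)).
Proof.
  intros Hm. pose proof (root_cut_diff_mult m x y Hm).
  pose proof (root_cut_ge0 m x). pose proof (root_cut_ge0 m y).
  assert (Rabs (root_cut m x - root_cut m y) <= root_cut m x + root_cut m y)
    by (apply Rabs_le; lra).
  rewrite <- (sqrt_pow2 (Rabs (root_cut m x - root_cut m y)))
    by apply Rabs_pos.
  apply sqrt_le_1_alt.
  pose proof (Rabs_pos (root_cut m x - root_cut m y)). nra.
Qed.

Lemma root_cut_lipschitz (m x y : R) : 0 < m ->
  Rabs (root_cut m x - root_cut m y) <= / root_cut m m * Rabs (x - y).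
Proof.
  intros Hm. pose proof (root_cut_diff_mult m x y (Rlt_le _ _ Hm)) as H.
  assert (Hmm : 0 < root_cut m m).
  { apply sqrt_lt_R0. rewrite Rmax_left; lra. }
  assert (Hge : forall z, root_cut m m <= root_cut m z).
  { intros z. destruct (Rle_dec z m).
    - rewrite (root_cut_below m z) by lra. lra.
    - apply root_cut_incr; lra. }
  pose proof (Hge x). pose proof (Hge y).
  pose proof (Rabs_pos (root_cut m x - root_cut m y)).
  apply Rmult_le_reg_l with (1 := Hmm). rewrite <- Rmult_assoc, Rinv_r by lra.
  nra.
Qed.

Lemma root_cut_continuous (m x : R) : 0 <= m -> continuous (root_cut m) x.
Proof.
  intros Hm. unfold root_cut.
  apply (continuous_comp (fun x => 2 * Rmax x m) sqrt).
  - apply (continuous_scal_r 2 (fun x => Rmax x m)).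
    apply (continuous_ext (fun x => (x + m + Rabs (x - m)) / 2)).
    + intros y. unfold Rmax, Rabs; destruct Rle_dec; destruct Rcase_abs; lra.
    + apply (continuous_mult (fun y => y + m + Rabs (y - m)) (fun _ => / 2)).
      * apply (continuous_plus (fun y => y + m) (fun y => Rabs (y - m))).
        -- apply (continuous_plus (fun y : R => y) (fun _ => m));
             [apply continuous_id | apply continuous_const].
        -- apply (continuous_comp (fun y => y - m) Rabs).
           ++ apply (continuous_minus (fun y : R => y) (fun _ => m));
                [apply continuous_id | apply continuous_const].
           ++ apply continuous_Rabs.
      * apply continuous_const.
  - apply continuous_sqrt.
Qed.

(** [root_cut m y] is a subgradient at [y] of the convex primitive. *)
Lemma root_cut_primitive_convex (m x y : R) : 0 <= m ->
  root_cut m y * (x - y) <= root_cut_primitive m x - root_cut_primitive m y.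
Proof.
  intros Hm. unfold root_cut_primitive.
  assert (Hcore : forall b a, 0 <= a -> 0 <= b ->
            b * (a ^ 2 - b ^ 2) / 2 <= (a ^ 3 - b ^ 3) / 3).
  { intros b a Ha Hb.
    assert (0 <= (a - b) ^ 2 * (2 * a + b)).
    { apply Rmult_le_pos; [apply pow2_ge_0 | lra]. }
    nra. }
  pose proof (root_cut_sqr m x Hm) as Hx. pose proof (root_cut_sqr m y Hm) as Hy.
  pose proof (root_cut_ge0 m x). pose proof (root_cut_ge0 m y).
  pose proof (Hcore (root_cut m y) (root_cut m x)) as Hxy.
  rewrite Hx, Hy in Hxy.
  destruct (Rle_dec y m) as [Hym|Hym].
  - rewrite (root_cut_below m y) in * by lra.
    rewrite (Rmax_right y m) in * by lra. nra.
  - rewrite (Rmax_left y m) in * by lra.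
    assert (root_cut m m <= root_cut m y) by (apply root_cut_incr; lra).
    pose proof (Rmax_l x m). nra.
Qed.

Lemma root_cut_primitive_derive (m x : R) : 0 <= m ->
  is_derive (root_cut_primitive m) x (root_cut m x).
Proof.
  intros Hm. apply is_derive_Reals. intros eps Heps.
  pose proof (root_cut_continuous m x Hm) as Hc.
  apply (proj1 (filterlim_locally _ _)) with (eps := mkposreal eps Heps) in Hc.
  destruct Hc as [d Hd]. exists d. intros h Hh Hhd.
  assert (Hb : Rabs (root_cut m (x + h) - root_cut m x) < eps).
  { apply (Hd (x + h)). change (Rabs (x + h - x) < d).
    replace (x + h - x) with h by ring. auto. }
  pose proof (root_cut_primitive_convex m (x + h) x Hm) as H1.
  pose proof (root_cut_primitive_convex m x (x + h) Hm) as H2.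
  set (D := root_cut_primitive m (x + h) - root_cut_primitive m x) in *.
  assert (HD : Rabs (D - root_cut m x * h)
               <= Rabs ((root_cut m (x + h) - root_cut m x) * h)).
  { rewrite Rabs_pos_eq by (unfold D in *; lra).
    eapply Rle_trans; [|apply Rle_abs]. unfold D in *. lra. }
  rewrite Rabs_mult in HD.
  replace (D / h - root_cut m x) with ((D - root_cut m x * h) / h)
    by (field; auto).
  unfold Rdiv. rewrite Rabs_mult, Rabs_inv.
  assert (Hp : 0 < Rabs h) by (apply Rabs_pos_lt; auto).
  apply Rmult_lt_reg_r with (1 := Hp).
  rewrite Rmult_assoc, Rinv_l, Rmult_1_r by lra. nra.
Qed.

(** * Solutions of the truncated problem and their energy *)

(** Solutions with two-sided derivatives at every point of [0, S], written as a
    first-order system for [u] and [v = u']; [c] is the damping coefficient and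
    [a] the initial value of [u]. *)
Definition cut_solution (m c S a : R) (u v : R -> R) : Prop :=
  u 0 = a /\ v 0 = 0 /\
  forall s, 0 <= s <= S ->
    is_derive u s (v s) /\
    is_derive v s (1 - c * v s - root_cut m (u s)).

(** Kinetic plus potential energy; the force [1 - root_cut m u] has the
    potential [root_cut_primitive m u - u]. *)
Definition energy (m : R) (u v : R -> R) (s : R) : R :=
  v s ^ 2 / 2 + root_cut_primitive m (u s) - u s.

Lemma energy_derive (m c S a : R) (u v : R -> R) :
  0 <= m -> cut_solution m c S a u v ->
  forall s, 0 <= s <= S -> is_derive (energy m u v) s (- c * v s ^ 2).
Proof.
  intros Hm (_ & _ & Hd) s Hs. destruct (Hd s Hs) as [Hu Hv].
  assert (HP : is_derive (fun x => root_cut_primitive m (u x)) s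
                 (v s * root_cut m (u s))).
  { apply (is_derive_comp (root_cut_primitive m) u); auto.
    apply root_cut_primitive_derive; auto. }
  unfold energy.
  replace (- c * v s ^ 2)
    with (v s * (1 - c * v s - root_cut m (u s)) + v s * root_cut m (u s) - v s)
    by ring.
  apply (is_derive_minus (fun x => v x ^ 2 / 2 + root_cut_primitive m (u x)) u);
    auto.
  apply (is_derive_plus (fun x => v x ^ 2 / 2)); auto.
  auto_derive; [eexists; exact Hv|].
  replace (Derive (fun x => v x) s) with (1 - c * v s - root_cut m (u s))
    by (symmetry; apply is_derive_unique; auto).
  field.
Qed.

Lemma energy_nonincreasing (m c S a : R) (u v : R -> R) :
  0 <= m -> 0 <= c -> cut_solution m c S a u v ->
  forall s t, 0 <= s <= t -> t <= S -> energy m u v t <= energy m u v s.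
Proof.
  intros Hm Hc Hsol.
  apply (nonincreasing_of_derive S _ (fun s => - c * v s ^ 2)).
  - intros s Hs. eapply energy_derive; eauto.
  - intros s Hs. pose proof (pow2_ge_0 (v s)). nra.
Qed.

(** Friction dissipates at least an amount proportional to the square of the
    displacement, by the Cauchy-Schwarz inequality for [u t - a], which is the
    integral of [v] over [0, t]. *)
Lemma energy_dissipation (m c S a : R) (u v : R -> R) :
  0 <= m -> 0 <= c -> 0 < S -> cut_solution m c S a u v ->
  forall t, 0 <= t <= S ->
    energy m u v t <= root_cut_primitive m a - a - c / S * (u t - a) ^ 2.
Proof.
  intros Hm Hc HS Hsol t Ht. pose proof Hsol as (Hu0 & Hv0 & Hd).
  (* Cauchy-Schwarz in the form [v^2 >= 2 k v - k^2]; replacing the mean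
     velocity [(u t - a) / t] by the following [k] only loses the factor
     [t / S] and avoids dividing by [t = 0]. *)
  set (k := (u t - a) / S).
  assert (H : energy m u v t + c * (2 * k * u t - k ^ 2 * t)
              <= energy m u v 0 + c * (2 * k * u 0 - k ^ 2 * 0)).
  { apply (nonincreasing_of_derive S
             (fun s => energy m u v s + c * (2 * k * u s - k ^ 2 * s))
             (fun s => - c * v s ^ 2 + c * (2 * k * v s - k ^ 2)));
      try lra.
    - intros s Hs. destruct (Hd s Hs) as [Hu Hv].
      apply (is_derive_plus (energy m u v)).
      + eapply energy_derive; eauto.
      + auto_derive; [exists (v s); exact Hu|].
        replace (Derive (fun x => u x) s) with (v s)
          by (symmetry; apply is_derive_unique; auto).
        ring.
    - intros s Hs. pose proof (pow2_ge_0 (v s - k)). nra. }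
  unfold energy at 2 in H. rewrite Hu0, Hv0 in H.
  assert (Hk : u t - a = k * S) by (unfold k; field; lra).
  replace (c / S * (u t - a) ^ 2) with (c * (k ^ 2 * S))
    by (rewrite Hk; field; lra).
  assert (c * (2 * k * u t - k ^ 2 * t) - c * (2 * k * a)
          >= c * (k ^ 2 * S)).
  { replace (c * (2 * k * u t - k ^ 2 * t) - c * (2 * k * a))
      with (c * (2 * k * (u t - a) - k ^ 2 * t)) by ring.
    rewrite Hk. apply Rle_ge, Rmult_le_compat_l; auto.
    pose proof (pow2_ge_0 k). nra. }
  lra.
Qed.

Lemma potential_dissipation (m c S a : R) (u v : R -> R) :
  0 <= m -> 0 <= c -> 0 < S -> cut_solution m c S a u v ->
  forall t, 0 <= t <= S ->
    root_cut_primitive m (u t) - u t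
      <= root_cut_primitive m a - a - c / S * (u t - a) ^ 2.
Proof.
  intros Hm Hc HS Hsol t Ht.
  pose proof (energy_dissipation m c S a u v Hm Hc HS Hsol t Ht) as H.
  unfold energy in H. pose proof (pow2_ge_0 (v t)). lra.
Qed.

(** The potential energy is nonpositive on the range of initial data. *)
Lemma potential_le0 (m a : R) :
  0 <= m <= a -> a <= 9 / 8 -> root_cut_primitive m a - a <= 0.
Proof.
  intros Hm Ha. unfold root_cut_primitive.
  pose proof (root_cut_sqr m a (proj1 Hm)) as Hsq.
  pose proof (root_cut_ge0 m a). rewrite Rmax_left in * by lra.
  set (h := root_cut m a) in *.
  assert (h <= 3 / 2) by nra. nra.
Qed.

Lemma potential_gt_below (m x : R) : 0 <= m <= 1 / 2 -> x < m ->
  - m < root_cut_primitive m x - x.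
Proof.
  intros Hm Hx. unfold root_cut_primitive.
  rewrite root_cut_below by lra. rewrite Rmax_right by lra.
  pose proof (root_cut_sqr m m (proj1 Hm)) as Hsq.
  pose proof (root_cut_ge0 m m). rewrite Rmax_left in Hsq by lra.
  set (h := root_cut m m) in *.
  assert (h <= 1) by nra.
  destruct (Req_dec h 0) as [E|E].
  - rewrite E in *. nra.
  - assert (0 < h ^ 3) by (apply pow_lt; lra). nra.
Qed.

Lemma potential_ge_above (m x : R) : 0 <= m <= x ->
  - x <= root_cut_primitive m x - x.
Proof.
  intros Hm. unfold root_cut_primitive. rewrite Rmax_left by lra.
  pose proof (pow_le _ 3 (root_cut_ge0 m x)). lra.
Qed.

(** If [m] is small compared with [a], the solution never enters the region
    where the cut-off is active. *)
Lemma cut_solution_ge_cut (m c S a : R) (u v : R -> R) :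
  0 < c -> 0 < S -> 0 <= a <= 9 / 8 ->
  0 <= m -> m <= a / 2 -> m <= 1 / 2 -> m <= c / (4 * S) * a ^ 2 ->
  cut_solution m c S a u v ->
  forall s, 0 <= s <= S -> m <= u s.
Proof.
  intros Hc HS Ha Hm Hm1 Hm2 Hm3 Hsol s Hs.
  destruct (Rle_dec m (u s)) as [|Hlt]; auto. exfalso.
  pose proof (potential_dissipation m c S a u v Hm (Rlt_le _ _ Hc) HS Hsol s Hs).
  pose proof (potential_le0 m a ltac:(lra) ltac:(lra)).
  pose proof (potential_gt_below m (u s) ltac:(lra) ltac:(lra)).
  assert (Hcs : 0 < c / S) by (apply Rdiv_lt_0_compat; auto).
  replace (c / (4 * S) * a ^ 2) with (c / S * (a ^ 2 / 4)) in Hm3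
    by (field; lra).
  assert (a ^ 2 / 4 <= (u s - a) ^ 2) by nra.
  nra.
Qed.

(** For a solution of the original problem the energy gives a lower bound that
    depends on [a] only. *)
Lemma solution_lower_bound (c S a : R) (u v : R -> R) :
  0 < c -> 0 < S -> 0 <= a <= 9 / 8 -> cut_solution 0 c S a u v ->
  forall s, 0 <= s <= S -> a / 2 <= u s \/ c / (4 * S) * a ^ 2 <= u s.
Proof.
  intros Hc HS Ha Hsol s Hs.
  assert (Hcs : 0 < c / S) by (apply Rdiv_lt_0_compat; auto).
  assert (Hcut : 0 <= u s).
  { apply (cut_solution_ge_cut 0 c S a u v); auto; try lra.
    replace (c / (4 * S) * a ^ 2) with (c / S * (a ^ 2 / 4)) by (field; lra).
    pose proof (pow2_ge_0 a). nra. }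
  pose proof (potential_dissipation 0 c S a u v (Rle_refl _)
                (Rlt_le _ _ Hc) HS Hsol s Hs).
  pose proof (potential_le0 0 a ltac:(lra) ltac:(lra)).
  pose proof (potential_ge_above 0 (u s) ltac:(lra)).
  destruct (Rle_dec (a / 2) (u s)) as [|Hn]; [left; auto | right].
  replace (c / (4 * S) * a ^ 2) with (c / S * (a ^ 2 / 4)) by (field; lra).
  assert (a ^ 2 / 4 <= (u s - a) ^ 2) by nra.
  nra.
Qed.

Lemma solution_ge0 (c S a : R) (u v : R -> R) :
  0 < c -> 0 < S -> 0 <= a <= 9 / 8 -> cut_solution 0 c S a u v ->
  forall s, 0 <= s <= S -> 0 <= u s.
Proof.
  intros Hc HS Ha Hsol s Hs.
  assert (0 <= c / (4 * S) * a ^ 2).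
  { apply Rmult_le_pos; [|apply pow2_ge_0].
    left; apply Rdiv_lt_0_compat; lra. }
  destruct (solution_lower_bound c S a u v Hc HS Ha Hsol s Hs); lra.
Qed.

(** Nonpositive energy confines [sqrt (2 u)] to [0, 3/2]. *)
Lemma solution_upper_bound (c S a : R) (u v : R -> R) :
  0 < c -> 0 < S -> 0 <= a <= 9 / 8 -> cut_solution 0 c S a u v ->
  forall s, 0 <= s <= S -> u s <= 9 / 8 /\ (a < 9 / 8 -> u s < 9 / 8).
Proof.
  intros Hc HS Ha Hsol s Hs.
  assert (Hcs : 0 < c / S) by (apply Rdiv_lt_0_compat; auto).
  pose proof (solution_ge0 c S a u v Hc HS Ha Hsol s Hs) as Hu.
  pose proof (potential_dissipation 0 c S a u v (Rle_refl _)
                (Rlt_le _ _ Hc) HS Hsol s Hs) as H1.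
  pose proof (potential_le0 0 a ltac:(lra) ltac:(lra)) as H2.
  unfold root_cut_primitive in H1 at 1. rewrite Rmax_left in H1 by lra.
  pose proof (root_cut_sqr 0 (u s) (Rle_refl _)) as Hsq.
  rewrite Rmax_left in Hsq by lra.
  pose proof (root_cut_ge0 0 (u s)). set (h := root_cut 0 (u s)) in *.
  pose proof (pow2_ge_0 (u s - a)).
  assert (Hle : u s <= 9 / 8).
  { assert (Hh : h ^ 2 * (h - 3 / 2) <= 0) by nra.
    assert (h <= 3 / 2).
    { destruct (Rle_dec h (3 / 2)) as [|Hn]; auto.
      pose proof (pow_lt h 2 ltac:(lra)). nra. }
    nra. }
  split; auto. intros Hlt. destruct Hle as [|Heq]; auto. exfalso.
  assert (h = 3 / 2) by nra.
  assert (0 < (u s - a) ^ 2) by (rewrite Heq; apply pow_lt; lra).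
  nra.
Qed.

(** * A lower bound that is uniform in the initial data *)

(** As long as [u <= 1/8], the restoring force is at most [1/2] and [u] grows
    at least quadratically. *)
Lemma quadratic_growth (c S a s : R) (u v : R -> R) :
  0 < c -> cut_solution 0 c S a u v -> 0 <= s <= S ->
  (forall t, 0 <= t <= s -> u t <= 1 / 8) ->
  a + exp (- (c * S)) / 4 * s ^ 2 <= u s.
Proof.
  intros Hc (Hu0 & Hv0 & Hd) Hs Hsmall.
  assert (Hv : forall t, 0 <= t <= s -> exp (- (c * S)) / 2 * t <= v t).
  { intros t Ht.
    assert (H : t / 2 - exp (c * t) * v t <= 0 / 2 - exp (c * 0) * v 0).
    { apply (nonincreasing_of_derive s
               (fun r => r / 2 - exp (c * r) * v r)
               (fun r => 1 / 2 - exp (c * r) * (1 - root_cut 0 (u r))));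
        try lra.
      - intros r Hr. destruct (Hd r ltac:(lra)) as [_ Hvr].
        auto_derive; [exists (1 - c * v r - root_cut 0 (u r)); exact Hvr|].
        replace (Derive (fun y => v y) r) with (1 - c * v r - root_cut 0 (u r))
          by (symmetry; apply is_derive_unique; auto).
        field.
      - intros r Hr.
        assert (root_cut 0 (u r) <= 1 / 2).
        { pose proof (root_cut_sqr 0 (u r) (Rle_refl _)) as Hsq.
          pose proof (Hsmall r Hr).
          assert (Rmax (u r) 0 <= 1 / 8) by (apply Rmax_lub; lra). nra. }
        assert (1 <= exp (c * r)).
        { pose proof (exp_ineq1_le (c * r)). nra. }
        nra. }
    rewrite Hv0 in H.
    assert (HE : exp (- (c * S)) * exp (c * t) <= 1).
    { rewrite <- exp_plus, <- exp_0. destruct (Req_dec t S) as [->|].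
      - right. f_equal. ring.
      - left. apply exp_increasing. nra. }
    pose proof (exp_pos (c * t)). pose proof (exp_pos (- (c * S))).
    apply Rmult_le_reg_l with (1 := exp_pos (c * t)). nra. }
  assert (H : exp (- (c * S)) / 4 * s ^ 2 - u s
              <= exp (- (c * S)) / 4 * 0 ^ 2 - u 0).
  { apply (nonincreasing_of_derive s
             (fun r => exp (- (c * S)) / 4 * r ^ 2 - u r)
             (fun r => exp (- (c * S)) / 2 * r - v r)); try lra.
    - intros r Hr. destruct (Hd r ltac:(lra)) as [Hur _].
      apply (is_derive_minus (fun x => exp (- (c * S)) / 4 * x ^ 2) u); auto.
      auto_derive; auto. field.
    - intros r Hr. pose proof (Hv r Hr). lra. }
  rewrite Hu0 in H. lra.
Qed.

(** Once [u] has exceeded [1/8], too much energy has been dissipated for it to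
    come close to [0] again. *)
Lemma late_lower_bound (c S a t s : R) (u v : R -> R) :
  0 < c -> 0 < S -> 0 <= a <= 1 / 32 -> cut_solution 0 c S a u v ->
  0 <= t <= s -> s <= S -> 1 / 8 < u t -> c / S * (9 / 1024) <= u s.
Proof.
  intros Hc HS Ha Hsol Ht Hs Hut.
  assert (Hcs : 0 < c / S) by (apply Rdiv_lt_0_compat; auto).
  pose proof (energy_nonincreasing 0 c S a u v (Rle_refl _) (Rlt_le _ _ Hc)
                Hsol t s Ht Hs) as H1.
  pose proof (energy_dissipation 0 c S a u v (Rle_refl _) (Rlt_le _ _ Hc) HS
                Hsol t ltac:(lra)) as H2.
  pose proof (potential_le0 0 a ltac:(lra) ltac:(lra)).
  pose proof (solution_ge0 c S a u v Hc HS ltac:(lra) Hsol s ltac:(lra)).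
  pose proof (potential_ge_above 0 (u s) ltac:(lra)).
  unfold energy at 1 in H1. pose proof (pow2_ge_0 (v s)).
  assert (9 / 1024 <= (u t - a) ^ 2) by nra.
  nra.
Qed.

(** The square root of [2 u] is bounded below by a multiple of [alpha + s].
    This makes the singularity of the square root at [0] harmless. *)
Lemma uniform_lower_bound (c S : R) : 0 < c -> 0 < S ->
  exists q, 0 < q /\
    forall alpha u v, 0 <= alpha <= 3 / 2 ->
      cut_solution 0 c S (/ 2 * alpha ^ 2) u v ->
      forall s, 0 <= s <= S -> q * (alpha + s) ^ 2 <= 2 * u s.
Proof.
  intros Hc HS.
  assert (Hcs : 0 < c / S) by (apply Rdiv_lt_0_compat; auto).
  set (k := exp (- (c * S)) / 4).
  assert (Hk : 0 < k) by (unfold k; pose proof (exp_pos (- (c * S))); lra).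
  set (m := Rmin (1 / 64) (c / S / 4096)).
  assert (Hm : 0 < m) by (apply Rmin_pos; lra).
  assert (Hm1 : m <= 1 / 64) by apply Rmin_l.
  assert (Hm2 : m <= c / S / 4096) by apply Rmin_r.
  set (N := 3 / 2 + S).
  assert (HN0 : 0 < N) by (unfold N; lra).
  assert (HN : 0 < N ^ 2) by (apply pow_lt; auto).
  set (q := Rmin (Rmin (1 / 2) k) (2 * m / N ^ 2)).
  assert (Hq0 : 0 < 2 * m / N ^ 2) by (apply Rdiv_lt_0_compat; lra).
  assert (Hq : 0 < q) by (repeat apply Rmin_pos; lra).
  assert (Hq1 : q <= 1 / 2)
    by (eapply Rle_trans; [apply Rmin_l | apply Rmin_l]).
  assert (Hq2 : q <= k) by (eapply Rle_trans; [apply Rmin_l | apply Rmin_r]).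
  assert (Hq3 : q * N ^ 2 <= 2 * m).
  { replace (2 * m) with (2 * m / N ^ 2 * N ^ 2) by (field; lra).
    apply Rmult_le_compat_r; [lra | apply Rmin_r]. }
  exists q; split; auto.
  intros alpha u v Hal Hsol s Hs.
  set (a := / 2 * alpha ^ 2) in *.
  assert (Ha : 0 <= a <= 9 / 8).
  { unfold a. pose proof (pow_incr alpha (3 / 2) 2 Hal).
    pose proof (pow2_ge_0 alpha). lra. }
  assert (Hfar : m <= u s -> q * (alpha + s) ^ 2 <= 2 * u s).
  { intros H. assert ((alpha + s) ^ 2 <= N ^ 2)
      by (apply pow_incr; unfold N; lra).
    pose proof (Rmult_le_compat_l q _ _ (Rlt_le _ _ Hq) H0). lra. }
  (* For [a >= 1/32] the energy bound suffices; otherwise it matters whether [u]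
     has exceeded [1/8] before time [s]. *)
  destruct (Rle_dec (1 / 32) a) as [Hbig|Hsmall].
  - apply Hfar.
    destruct (solution_lower_bound c S a u v Hc HS Ha Hsol s Hs) as [H|H];
      [lra|].
    replace (c / (4 * S) * a ^ 2) with (c / S * (a ^ 2 / 4)) in H
      by (field; lra).
    assert (1 / 4096 <= a ^ 2 / 4) by nra. nra.
  - destruct (classic (exists t, 0 <= t <= s /\ 1 / 8 < u t))
      as [(t & Ht & Hut)|Hno].
    + apply Hfar.
      pose proof (late_lower_bound c S a t s u v Hc HS ltac:(lra) Hsol Ht
                    (proj2 Hs) Hut). lra.
    + pose proof (quadratic_growth c S a s u v Hc Hsol Hs) as H.
      assert (Hall : forall t, 0 <= t <= s -> u t <= 1 / 8).
      { intros t Ht. destruct (Rle_dec (u t) (1 / 8)); auto.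
        exfalso; apply Hno; exists t; lra. }
      specialize (H Hall). fold k in H. unfold a in H.
      assert ((alpha + s) ^ 2 <= 2 * alpha ^ 2 + 2 * s ^ 2)
        by (pose proof (pow2_ge_0 (alpha - s)); nra).
      pose proof (pow2_ge_0 alpha). pose proof (pow2_ge_0 s). nra.
Qed.

(** * Lipschitz dependence on the initial data *)

(** [M] is the maximum of [|p|] in the norm weighted by [exp (- (l * s))],
    attained at [s0]. *)
Lemma abs_mult_exp_max (S : R) (p : R -> R) (l : R) : 0 < S ->
  (forall s, 0 <= s <= S -> ex_derive p s) ->
  exists M s0, 0 <= s0 <= S /\ Rabs (p s0) = M * exp (l * s0) /\
    forall s, 0 <= s <= S -> Rabs (p s) <= M * exp (l * s).
Proof.
  intros HS Hp.
  destruct (continuity_ab_maj (fun s => Rabs (p s) * exp (- (l * s))) 0 S)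
    as [s0 [Hmax Hs0]].
  - lra.
  - intros s Hs. apply continuity_pt_filterlim.
    apply (continuous_mult (fun s => Rabs (p s)) (fun s => exp (- (l * s)))).
    + apply (continuous_comp p Rabs).
      * apply (ex_derive_continuous p); auto.
      * apply continuous_Rabs.
    + apply (ex_derive_continuous (fun x => exp (- (l * x)))).
      auto_derive; auto.
  - assert (Hinv : forall x, exp (- x) * exp x = 1).
    { intros x. rewrite <- exp_plus, <- exp_0. f_equal. ring. }
    exists (Rabs (p s0) * exp (- (l * s0))), s0. split; auto. split.
    + rewrite Rmult_assoc, Hinv. ring.
    + intros s Hs. rewrite <- (Rmult_1_r (Rabs (p s))), <- (Hinv (l * s)),
        <- Rmult_assoc.
      apply Rmult_le_compat_r; [left; apply exp_pos | auto].
Qed.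

Lemma lipschitz_dependence (c S : R) : 0 < c -> 0 < S ->
  exists C, 0 <= C /\
    forall al1 al2 u1 v1 u2 v2,
      0 <= al1 <= 3 / 2 -> 0 <= al2 <= 3 / 2 ->
      cut_solution 0 c S (/ 2 * al1 ^ 2) u1 v1 ->
      cut_solution 0 c S (/ 2 * al2 ^ 2) u2 v2 ->
      forall s, 0 <= s <= S -> Rabs (u1 s - u2 s) <= C * Rabs (al1 - al2).
Proof.
  intros Hc HS.
  destruct (uniform_lower_bound c S Hc HS) as (q & Hq & Hlow).
  set (k := sqrt q).
  assert (Hk : 0 < k) by (apply sqrt_lt_R0; auto).
  assert (Hk2 : k ^ 2 = q) by (apply pow2_sqrt; lra).
  set (l := 2 / k).
  assert (Hl : 0 < l) by (apply Rdiv_lt_0_compat; lra).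
  assert (Hlk : l * k = 2) by (unfold l; field; lra).
  clearbody k l.
  exists (3 / 2 + 2 * S ^ 2 * exp (l * S) / k). split.
  { assert (0 <= 2 * S ^ 2 * exp (l * S) / k); [|lra].
    apply Rmult_le_pos; [|left; apply Rinv_0_lt_compat; auto].
    apply Rmult_le_pos; [|left; apply exp_pos]. nra. }
  intros al1 al2 u1 v1 u2 v2 Hal1 Hal2 Hsol1 Hsol2 s Hs.
  set (D := Rabs (al1 - al2)).
  assert (HD : 0 <= D) by apply Rabs_pos.
  (* In terms of the square roots, the lower bound is linear. *)
  assert (Hroot : forall al u v, 0 <= al <= 3 / 2 ->
            cut_solution 0 c S (/ 2 * al ^ 2) u v ->
            forall r, 0 <= r <= S -> k * (al + r) <= root_cut 0 (u r)).
  { intros al u v Hal Hsol r Hr. specialize (Hlow al u v Hal Hsol r Hr).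
    rewrite <- (sqrt_pow2 (k * (al + r))) by (apply Rmult_le_pos; lra).
    apply sqrt_le_1_alt.
    replace ((k * (al + r)) ^ 2) with (q * (al + r) ^ 2).
    - pose proof (Rmax_l (u r) 0). lra.
    - rewrite Rpow_mult_distr, Hk2. ring. }
  pose proof (Hroot al1 u1 v1 Hal1 Hsol1) as Hr1.
  pose proof (Hroot al2 u2 v2 Hal2 Hsol2) as Hr2. clear Hroot Hlow.
  destruct Hsol1 as (Hu10 & Hv10 & Hd1). destruct Hsol2 as (Hu20 & Hv20 & Hd2).
  set (w := fun r => u1 r - u2 r). set (p := fun r => v1 r - v2 r).
  assert (Hw : forall r, 0 <= r <= S -> is_derive w r (p r)).
  { intros r Hr. apply (is_derive_minus u1 u2).
    - apply Hd1; auto.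
    - apply Hd2; auto. }
  set (g := fun r => root_cut 0 (u2 r) - root_cut 0 (u1 r)).
  assert (Hp : forall r, 0 <= r <= S -> is_derive p r (g r - c * p r)).
  { intros r Hr. unfold g, p.
    replace (root_cut 0 (u2 r) - root_cut 0 (u1 r) - c * (v1 r - v2 r))
      with ((1 - c * v1 r - root_cut 0 (u1 r))
            - (1 - c * v2 r - root_cut 0 (u2 r))) by ring.
    apply (is_derive_minus v1 v2).
    - apply Hd1; auto.
    - apply Hd2; auto. }
  destruct (abs_mult_exp_max S p l HS) as (M & s0 & Hs0 & HM & Hmax).
  { intros r Hr. eexists. apply Hp; auto. }
  assert (HM0 : 0 <= M).
  { pose proof (Rabs_pos (p s0)). pose proof (exp_pos (l * s0)). nra. }
  assert (Hw0 : 2 * Rabs (w 0) = D * (al1 + al2)).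
  { unfold w, D. rewrite Hu10, Hu20.
    replace (/ 2 * al1 ^ 2 - / 2 * al2 ^ 2)
      with (/ 2 * ((al1 - al2) * (al1 + al2))) by ring.
    rewrite !Rabs_mult, (Rabs_pos_eq (/ 2)), (Rabs_pos_eq (al1 + al2)) by lra.
    field. }
  assert (Hwb : forall r, 0 <= r <= S ->
            Rabs (w r) <= Rabs (w 0) + r * M * exp (l * r)).
  { apply (abs_le_of_derive S w p (fun r => Rabs (w 0) + r * M * exp (l * r))
             (fun r => M * exp (l * r) + r * M * l * exp (l * r))); auto.
    - intros r Hr. auto_derive; auto. ring.
    - intros r Hr. pose proof (Hmax r Hr). pose proof (exp_pos (l * r)).
      assert (0 <= r * M * l * exp (l * r)); [|lra].
      repeat apply Rmult_le_pos; lra.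
    - lra. }
  (* The kernel [1 / (alpha + s)] is compensated by the factor [s] in the bound
     on the displacement [w]. *)
  assert (Hg : forall r, 0 <= r <= S -> Rabs (g r) <= (D + M * exp (l * r)) / k).
  { intros r Hr. unfold g. rewrite Rabs_minus_sym.
    pose proof (root_cut_diff_mult 0 (u1 r) (u2 r) (Rle_refl _)) as H.
    pose proof (Hr1 r Hr). pose proof (Hr2 r Hr).
    pose proof (Hwb r Hr) as Hwr. unfold w at 1 in Hwr.
    set (h := root_cut 0 (u1 r) + root_cut 0 (u2 r)) in *.
    set (d := Rabs (root_cut 0 (u1 r) - root_cut 0 (u2 r))) in *.
    pose proof (exp_pos (l * r)) as He.
    assert (HX : 0 <= D + M * exp (l * r)) by nra.
    assert (Hh : k * (al1 + al2 + 2 * r) <= h) by (unfold h; lra).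
    assert (Hdh : d * h <= (D + M * exp (l * r)) * (al1 + al2 + 2 * r)).
    { assert (0 <= M * exp (l * r) * (al1 + al2))
        by (repeat apply Rmult_le_pos; lra).
      assert (0 <= D * r) by (apply Rmult_le_pos; lra).
      lra. }
    apply Rmult_le_reg_r with (1 := Hk).
    replace ((D + M * exp (l * r)) / k * k) with (D + M * exp (l * r))
      by (field; lra).
    destruct (Rle_dec h 0) as [Hh0|Hh0].
    - assert (d = 0); [|nra].
      pose proof (root_cut_ge0 0 (u1 r)). pose proof (root_cut_ge0 0 (u2 r)).
      unfold h in Hh0. unfold d.
      replace (root_cut 0 (u1 r) - root_cut 0 (u2 r)) with 0 by lra.
      apply Rabs_R0.
    - apply Rmult_le_reg_r with (r := h); [lra|].
      apply Rle_trans with (k * ((D + M * exp (l * r)) * (al1 + al2 + 2 * r)));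
        nra. }
  assert (Hpb : forall r, 0 <= r <= S ->
            Rabs (p r) <= (D * r + M * exp (l * r) / l) / k).
  { assert (Hpos : forall r, 0 <= r ->
              0 <= (D * r + M * exp (l * r) / l) / k).
    { intros r Hr. pose proof (exp_pos (l * r)).
      pose proof (Rinv_0_lt_compat _ Hl). pose proof (Rinv_0_lt_compat _ Hk).
      apply Rmult_le_pos; [|lra]. apply Rplus_le_le_0_compat.
      - apply Rmult_le_pos; auto.
      - apply Rmult_le_pos; [apply Rmult_le_pos|]; lra. }
    apply (damped_abs_le c S p g _ (fun r => (D + M * exp (l * r)) / k)); auto.
    - lra.
    - intros r Hr. auto_derive; auto. field; lra.
    - intros r Hr. apply Hpos; lra.
    - unfold p. rewrite Hv10, Hv20, Rminus_0_r, Rabs_R0. apply Hpos; lra. }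
  (* With [l = 2 / k] the exponential term absorbs only half of [M]. *)
  assert (HMb : M <= 2 * D * S / k).
  { pose proof (Hpb s0 Hs0) as H. rewrite HM in H.
    replace ((D * s0 + M * exp (l * s0) / l) / k)
      with (D * s0 / k + M * exp (l * s0) / 2) in H
      by (rewrite <- Hlk; field; lra).
    assert (H1 : 1 <= exp (l * s0)).
    { pose proof (exp_ineq1_le (l * s0)). nra. }
    assert (H2 : D * s0 / k <= D * S / k).
    { apply Rmult_le_compat_r; [left; apply Rinv_0_lt_compat; auto|].
      apply Rmult_le_compat_l; lra. }
    replace (2 * D * S / k) with (2 * (D * S / k)) by (field; lra).
    nra. }
  eapply Rle_trans; [apply (Hwb s Hs)|].
  rewrite Rmult_plus_distr_r. apply Rplus_le_compat; [nra|].
  apply Rle_trans with (S * (2 * D * S / k) * exp (l * S)).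
  - pose proof (exp_pos (l * s)). apply Rmult_le_compat.
    + apply Rmult_le_pos; lra.
    + lra.
    + apply Rmult_le_compat; lra.
    + destruct (Req_dec s S) as [->|]; [lra|].
      left; apply exp_increasing. nra.
  - right. unfold D. field. lra.
Qed.

(** * Existence by successive approximations *)

(** The projection of the real line onto [0, S]. *)
Definition clamp (S x : R) : R := Rmax 0 (Rmin x S).

Lemma clamp_bounds (S x : R) : 0 <= S -> 0 <= clamp S x <= S.
Proof. intros H. unfold clamp, Rmax, Rmin; repeat destruct Rle_dec; lra. Qed.

Lemma clamp_id (S x : R) : 0 <= x <= S -> clamp S x = x.
Proof. intros H. unfold clamp, Rmax, Rmin; repeat destruct Rle_dec; lra. Qed.

Lemma clamp_continuous (S x : R) : continuous (clamp S) x.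
Proof.
  apply (proj2 (filterlim_locally _ _)). intros eps. exists eps. intros y Hy.
  change (Rabs (clamp S y - clamp S x) < eps).
  change (Rabs (y - x) < eps) in Hy.
  eapply Rle_lt_trans; [|exact Hy].
  unfold clamp, Rmax, Rmin, Rabs;
    repeat destruct Rle_dec; repeat destruct Rcase_abs; lra.
Qed.

(** Continuity on [0, S], expressed through constant extension. *)
Definition continuous_on_segment (S : R) (w : R -> R) : Prop :=
  forall x, continuous (fun r => w (clamp S r)) x.

Lemma derivable_continuous_on_segment (S : R) (w : R -> R) : 0 <= S ->
  (forall s, 0 <= s <= S -> ex_derive w s) -> continuous_on_segment S w.
Proof.
  intros HS Hw x. apply (continuous_comp (clamp S) w).
  - apply clamp_continuous.
  - apply (ex_derive_continuous w), Hw, clamp_bounds; auto.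
Qed.

Lemma uniform_limit_continuous_on_segment (S : R) (w : R -> R) : 0 <= S ->
  (forall eps, 0 < eps -> exists wn, continuous_on_segment S wn /\
     forall s, 0 <= s <= S -> Rabs (wn s - w s) <= eps) ->
  continuous_on_segment S w.
Proof.
  intros HS H x. apply (proj2 (filterlim_locally _ _)). intros eps.
  destruct (H (eps / 4)) as (wn & Hc & Hn).
  { pose proof (cond_pos eps). lra. }
  specialize (Hc x).
  assert (He : 0 < eps / 4) by (pose proof (cond_pos eps); lra).
  apply (proj1 (filterlim_locally _ _)) with (eps := mkposreal _ He) in Hc.
  destruct Hc as [d Hd]. exists d. intros y Hy. specialize (Hd y Hy).
  change (Rabs (wn (clamp S y) - wn (clamp S x)) < eps / 4) in Hd.
  change (Rabs (w (clamp S y) - w (clamp S x)) < eps).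
  pose proof (Hn _ (clamp_bounds S x HS)) as H1.
  pose proof (Hn _ (clamp_bounds S y HS)) as H2.
  apply Rabs_lt_between in Hd. apply Rabs_le_between in H1, H2.
  apply Rabs_lt_between. lra.
Qed.

(** The solution [v] of the linear equation [v' + c v = 1 - root_cut m w] with
    [v 0 = 0], by the integrating factor [exp (c t)]. *)
Definition picard_velocity (m c S : R) (w : R -> R) (t : R) : R :=
  exp (- (c * t)) *
    RInt (fun r => exp (c * r) * (1 - root_cut m (w (clamp S r)))) 0 t.

(** The Picard operator, whose fixed points are the solutions of the truncated
    problem. *)
Definition picard (m c S a : R) (w : R -> R) (s : R) : R :=
  a + RInt (picard_velocity m c S w) 0 s.

Lemma RInt_derive (f : R -> R) (x : R) :
  (forall y, continuous f y) -> is_derive (RInt f 0) x (f x).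
Proof.
  intros Hf. apply (is_derive_RInt f (RInt f 0) 0).
  - apply filter_forall. intros y. apply (@RInt_correct R_CompleteNormedModule).
    apply (@ex_RInt_continuous R_CompleteNormedModule). auto.
  - auto.
Qed.

Lemma picard_velocity_derive (m c S : R) (w : R -> R) (t : R) :
  0 <= m -> continuous_on_segment S w ->
  is_derive (picard_velocity m c S w) t
    (1 - root_cut m (w (clamp S t)) - c * picard_velocity m c S w t).
Proof.
  intros Hm Hw. unfold picard_velocity.
  set (f := fun r => exp (c * r) * (1 - root_cut m (w (clamp S r)))).
  assert (Hf : is_derive (RInt f 0) t (f t)).
  { apply RInt_derive. intros y.
    apply (continuous_mult (fun r => exp (c * r))
             (fun r => 1 - root_cut m (w (clamp S r)))).
    - apply (ex_derive_continuous (fun r => exp (c * r))). auto_derive; auto.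
    - apply (continuous_minus (fun _ => 1)
               (fun r => root_cut m (w (clamp S r)))).
      + apply continuous_const.
      + apply (continuous_comp (fun r => w (clamp S r)) (root_cut m)); auto.
        apply root_cut_continuous; auto. }
  replace (1 - root_cut m (w (clamp S t)) - c * (exp (- (c * t)) * RInt f 0 t))
    with (- c * exp (- (c * t)) * RInt f 0 t + exp (- (c * t)) * f t).
  - apply (is_derive_mult (fun t => exp (- (c * t))) (RInt f 0)); auto.
    + auto_derive; auto. ring.
    + intros; apply Rmult_comm.
  - unfold f at 2.
    assert (He : exp (- (c * t)) * exp (c * t) = 1).
    { rewrite <- exp_plus, <- exp_0. f_equal. ring. }
    rewrite <- Rmult_assoc, He. ring.
Qed.

Lemma picard_derive (m c S a : R) (w : R -> R) (s : R) :
  0 <= m -> continuous_on_segment S w ->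
  is_derive (picard m c S a w) s (picard_velocity m c S w s).
Proof.
  intros Hm Hw. unfold picard.
  rewrite <- (Rplus_0_l (picard_velocity m c S w s)).
  apply (is_derive_plus (fun _ => a)); [apply (is_derive_const a)|].
  apply RInt_derive. intros y. apply (ex_derive_continuous (V := R_NormedModule)).
  eexists. apply picard_velocity_derive; auto.
Qed.

Lemma picard_velocity_0 (m c S : R) (w : R -> R) :
  picard_velocity m c S w 0 = 0.
Proof.
  unfold picard_velocity. rewrite RInt_point. apply Rmult_0_r.
Qed.

Lemma picard_0 (m c S a : R) (w : R -> R) : picard m c S a w 0 = a.
Proof. unfold picard. rewrite RInt_point. apply Rplus_0_r. Qed.

Lemma picard_continuous_on_segment (m c S a : R) (w : R -> R) :
  0 <= S -> 0 <= m -> continuous_on_segment S w ->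
  continuous_on_segment S (picard m c S a w).
Proof.
  intros HS Hm Hw. apply derivable_continuous_on_segment; auto.
  intros s _. eexists. apply picard_derive; auto.
Qed.

(** A bound on the difference of the nonlinear terms is integrated twice. *)
Lemma picard_diff_le (m c S a : R) (x y : R -> R) (q dq ddq : R -> R) :
  0 <= m -> 0 <= c -> continuous_on_segment S x -> continuous_on_segment S y ->
  (forall s, 0 <= s <= S -> is_derive q s (dq s)) ->
  (forall s, 0 <= s <= S -> is_derive dq s (ddq s)) ->
  (forall s, 0 <= s <= S ->
     Rabs (root_cut m (x s) - root_cut m (y s)) <= ddq s) ->
  (forall s, 0 <= s <= S -> 0 <= dq s) -> 0 <= q 0 -> 0 <= dq 0 ->
  forall s, 0 <= s <= S ->
    Rabs (picard m c S a x s - picard m c S a y s) <= q s.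
Proof.
  intros Hm Hc Hx Hy Hq Hdq Hle Hpos Hq0 Hdq0.
  assert (Hv : forall s, 0 <= s <= S ->
    Rabs (picard_velocity m c S x s - picard_velocity m c S y s) <= dq s).
  { apply (damped_abs_le c S
      (fun s => picard_velocity m c S x s - picard_velocity m c S y s)
      (fun s => root_cut m (y s) - root_cut m (x s)) dq ddq); auto.
    - intros s Hs.
      replace (root_cut m (y s) - root_cut m (x s) -
          c * (picard_velocity m c S x s - picard_velocity m c S y s))
        with ((1 - root_cut m (x (clamp S s)) - c * picard_velocity m c S x s)
            - (1 - root_cut m (y (clamp S s)) - c * picard_velocity m c S y s))
        by (rewrite !clamp_id by auto; ring).
      apply (is_derive_minus (picard_velocity m c S x));
        apply picard_velocity_derive; auto.
    - intros s Hs. rewrite Rabs_minus_sym. auto.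
    - rewrite !picard_velocity_0, Rminus_0_r, Rabs_R0. auto. }
  apply (abs_le_of_derive S
    (fun s => picard m c S a x s - picard m c S a y s)
    (fun s => picard_velocity m c S x s - picard_velocity m c S y s) q dq); auto.
  - intros s Hs. apply (is_derive_minus (picard m c S a x));
      apply picard_derive; auto.
  - rewrite !picard_0, Rminus_diag, Rabs_R0. auto.
Qed.

(** A solution with initial value [a] is a fixed point of the Picard operator
    for the initial value [b] up to the error [b - a]. *)
Lemma cut_solution_picard (m c S a b : R) (u v : R -> R) :
  0 <= m -> 0 <= c -> 0 <= S -> cut_solution m c S a u v ->
  forall s, 0 <= s <= S -> picard m c S b u s = u s + (b - a).
Proof.
  intros Hm Hc HS (Hu0 & Hv0 & Hd).
  assert (Hcont : continuous_on_segment S u).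
  { apply derivable_continuous_on_segment; auto.
    intros s Hs. exists (v s). apply (Hd s Hs). }
  assert (Hv : forall s, 0 <= s <= S ->
            Rabs (picard_velocity m c S u s - v s) <= 0).
  { apply (damped_abs_le c S (fun s => picard_velocity m c S u s - v s)
             (fun _ => 0) (fun _ => 0) (fun _ => 0)); auto; try (intros; lra).
    - intros s Hs.
      replace (0 - c * (picard_velocity m c S u s - v s))
        with ((1 - root_cut m (u (clamp S s)) - c * picard_velocity m c S u s)
              - (1 - c * v s - root_cut m (u s)))
        by (rewrite clamp_id by auto; ring).
      apply (is_derive_minus (picard_velocity m c S u) v).
      + apply picard_velocity_derive; auto.
      + apply Hd; auto.
    - intros. apply (is_derive_const 0).
    - intros. rewrite Rabs_R0. lra.
    - rewrite picard_velocity_0, Hv0, Rminus_0_r, Rabs_R0. lra. }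
  intros s Hs.
  assert (Hu : Rabs (picard m c S b u s - u s - (b - a)) <= 0).
  { apply (abs_le_of_derive S (fun s => picard m c S b u s - u s - (b - a))
      (fun s => picard_velocity m c S u s - v s) (fun _ => 0) (fun _ => 0)); auto.
    - intros r Hr.
      rewrite <- (Rminus_0_r (picard_velocity m c S u r - v r)).
      apply (is_derive_minus (fun s => picard m c S b u s - u s)
               (fun _ => b - a)).
      + apply (is_derive_minus (picard m c S b u) u).
        * apply picard_derive; auto.
        * apply Hd; auto.
      + apply (is_derive_const (b - a)).
    - intros. apply (is_derive_const 0).
    - rewrite picard_0, Hu0, Rminus_diag, Rabs_R0. lra. }
  pose proof (Rabs_pos (picard m c S b u s - u s - (b - a))).
  apply Rabs_le_between in Hu. lra.
Qed.

(** A uniformly convergent sequence of approximate fixed points of the Picard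
    operator yields a solution. Only the Hoelder continuity of [root_cut m] is
    needed, so [m = 0] is allowed. *)
Lemma solution_of_approximations (m c S a : R) (w : nat -> R -> R) :
  0 <= m -> 0 <= c -> 0 < S ->
  (forall n, continuous_on_segment S (w n)) ->
  (forall eps, 0 < eps -> exists N, forall n k, (N <= n)%nat -> (N <= k)%nat ->
     forall s, 0 <= s <= S -> Rabs (w n s - w k s) < eps) ->
  (forall eps, 0 < eps -> exists N, forall n, (N <= n)%nat ->
     forall s, 0 <= s <= S -> Rabs (picard m c S a (w n) s - w n s) < eps) ->
  exists u v, cut_solution m c S a u v.
Proof.
  intros Hm Hc HS Hcont Hcauchy Happrox.
  set (wl := fun s => real (Lim_seq (fun n => w n s))).
  assert (Hlim : forall s, 0 <= s <= S -> is_lim_seq (fun n => w n s) (wl s)).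
  { intros s Hs. apply Lim_seq_correct', ex_lim_seq_cauchy_corr. intros eps.
    destruct (Hcauchy eps (cond_pos eps)) as [N HN]. exists N. auto. }
  assert (Hunif : forall eps, 0 < eps -> exists N, forall n, (N <= n)%nat ->
            forall s, 0 <= s <= S -> Rabs (w n s - wl s) <= eps).
  { intros eps Heps. destruct (Hcauchy eps Heps) as [N HN]. exists N.
    intros n Hn s Hs. apply le_epsilon. intros e He.
    specialize (Hlim s Hs). apply is_lim_seq_spec in Hlim.
    destruct (Hlim (mkposreal e He)) as [N' HN'].
    specialize (HN' (Nat.max N N') ltac:(lia)). simpl in HN'.
    specialize (HN n (Nat.max N N') Hn ltac:(lia) s Hs).
    apply Rabs_lt_between in HN, HN'. apply Rabs_le_between. lra. }
  assert (Hwl : continuous_on_segment S wl).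
  { apply uniform_limit_continuous_on_segment; [lra|].
    intros eps Heps. destruct (Hunif eps Heps) as [N HN].
    exists (w N). split; auto. }
  assert (Hbound : forall e, 0 < e <= 1 -> forall s, 0 <= s <= S ->
            Rabs (picard m c S a wl s - wl s) <= e * (S ^ 2 + 2)).
  { intros e He s Hs.
    destruct (Hunif (e ^ 2 / 2)) as [N1 HN1].
    { pose proof (pow_lt e 2 (proj1 He)). lra. }
    destruct (Happrox e (proj1 He)) as [N2 HN2].
    set (n := Nat.max N1 N2).
    specialize (HN1 n ltac:(lia)). specialize (HN2 n ltac:(lia) s Hs).
    assert (Hd : Rabs (picard m c S a (w n) s - picard m c S a wl s)
                 <= e * (s ^ 2 / 2)).
    { apply (picard_diff_le m c S a (w n) wl (fun s => e * (s ^ 2 / 2))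
               (fun s => e * s) (fun _ => e)); auto; try lra.
      - intros r Hr. auto_derive; auto. field.
      - intros r Hr. auto_derive; auto. ring.
      - intros r Hr. eapply Rle_trans; [apply root_cut_holder; auto|].
        rewrite <- (sqrt_pow2 e) by lra. apply sqrt_le_1_alt.
        specialize (HN1 r Hr). lra.
      - intros r Hr. apply Rmult_le_pos; lra. }
    specialize (HN1 s Hs).
    assert (e ^ 2 / 2 <= e) by nra.
    assert (e * (s ^ 2 / 2) <= e * S ^ 2).
    { apply Rmult_le_compat_l; [lra|]. nra. }
    apply Rabs_lt_between in HN2. apply Rabs_le_between in HN1, Hd.
    apply Rabs_le_between. lra. }
  assert (Hfix : forall s, 0 <= s <= S -> picard m c S a wl s = wl s).
  { intros s Hs. destruct (Req_dec (picard m c S a wl s - wl s) 0) as [|Hne];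
      [lra|]. exfalso.
    set (X := Rabs (picard m c S a wl s - wl s)).
    assert (HX : 0 < X) by (apply Rabs_pos_lt; auto).
    assert (HT : 0 < S ^ 2 + 2) by nra.
    assert (He : 0 < X / 2 / (S ^ 2 + 2)) by (apply Rdiv_lt_0_compat; lra).
    pose proof (Hbound (Rmin 1 (X / 2 / (S ^ 2 + 2)))) as H.
    specialize (H (conj (Rmin_pos 1 _ Rlt_0_1 He) (Rmin_l _ _)) s Hs). fold X in H.
    pose proof (Rmult_le_compat_r (S ^ 2 + 2) _ _ (Rlt_le _ _ HT)
                  (Rmin_r 1 (X / 2 / (S ^ 2 + 2)))) as H2.
    replace (X / 2 / (S ^ 2 + 2) * (S ^ 2 + 2)) with (X / 2) in H2
      by (field; lra).
    lra. }
  exists (picard m c S a wl), (picard_velocity m c S wl).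
  split; [apply picard_0 | split; [apply picard_velocity_0|]].
  intros s Hs. split; [apply picard_derive; auto|].
  replace (1 - c * picard_velocity m c S wl s - root_cut m (picard m c S a wl s))
    with (1 - root_cut m (wl (clamp S s)) - c * picard_velocity m c S wl s)
    by (rewrite Hfix, clamp_id by auto; ring).
  apply picard_velocity_derive; auto.
Qed.

Lemma geometric_cauchy (S B : R) (w : nat -> R -> R) :
  0 <= B ->
  (forall n s, 0 <= s <= S -> Rabs (w (n + 1)%nat s - w n s) <= B * (/ 2) ^ n) ->
  forall eps, 0 < eps -> exists N, forall n k, (N <= n)%nat -> (N <= k)%nat ->
    forall s, 0 <= s <= S -> Rabs (w n s - w k s) < eps.
Proof.
  intros HB Hstep eps Heps.
  assert (Hsum : forall n p s, 0 <= s <= S ->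
            Rabs (w (n + p)%nat s - w n s)
              <= 2 * B * (/ 2) ^ n * (1 - (/ 2) ^ p)).
  { intros n p s Hs. induction p as [|p IH].
    - rewrite Nat.add_0_r, Rminus_diag, Rabs_R0. simpl. lra.
    - replace (n + Datatypes.S p)%nat with (n + p + 1)%nat by lia.
      pose proof (Hstep (n + p)%nat s Hs) as H. rewrite pow_add in H.
      apply Rabs_le_between in IH, H. apply Rabs_le_between.
      simpl pow. lra. }
  assert (Hpow : forall n, 0 < (/ 2) ^ n) by (intros; apply pow_lt; lra).
  destruct (pow_lt_1_zero (/ 2)) with (y := eps / (4 * B + 1)) as [N HN].
  - rewrite Rabs_pos_eq; lra.
  - apply Rdiv_lt_0_compat; lra.
  - exists N.
    assert (HNN : 4 * B * (/ 2) ^ N < eps).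
    { specialize (HN N (Nat.le_refl _)). rewrite Rabs_pos_eq in HN
        by (left; apply Hpow).
      apply Rle_lt_trans with ((4 * B + 1) * (/ 2) ^ N).
      - pose proof (Hpow N). lra.
      - apply Rmult_lt_compat_l with (r := 4 * B + 1) in HN; [|lra].
        replace ((4 * B + 1) * (eps / (4 * B + 1))) with eps in HN
          by (field; lra). auto. }
    assert (Hfar : forall n s, (N <= n)%nat -> 0 <= s <= S ->
              Rabs (w n s - w N s) <= 2 * B * (/ 2) ^ N).
    { intros n s Hn Hs. replace n with (N + (n - N))%nat by lia.
      eapply Rle_trans; [apply Hsum; auto|].
      rewrite <- (Rmult_1_r (2 * B * (/ 2) ^ N)) at 2.
      apply Rmult_le_compat_l.
      - apply Rmult_le_pos; [lra | left; apply Hpow].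
      - pose proof (Hpow (n - N)%nat). lra. }
    intros n k Hn Hk s Hs.
    pose proof (Hfar n s Hn Hs) as H1. pose proof (Hfar k s Hk Hs) as H2.
    apply Rabs_le_between in H1, H2. apply Rabs_lt_between. lra.
Qed.

(** For a positive cut-off the Picard operator is a contraction for the weight
    [exp (l * s)] with [l] large enough. *)
Lemma picard_contraction (m c S a l K : R) (x y : R -> R) :
  0 < m -> 0 <= c -> 0 < l -> 0 <= K ->
  continuous_on_segment S x -> continuous_on_segment S y ->
  (forall s, 0 <= s <= S -> Rabs (x s - y s) <= K * exp (l * s)) ->
  forall s, 0 <= s <= S ->
    Rabs (picard m c S a x s - picard m c S a y s)
      <= K * (/ root_cut m m / l ^ 2) * exp (l * s).
Proof.
  intros Hm Hc Hl HK Hx Hy Hxy.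
  set (L := / root_cut m m).
  assert (HL : 0 < L).
  { apply Rinv_0_lt_compat, sqrt_lt_R0. rewrite Rmax_left; lra. }
  assert (HL1 : 0 < L / l) by (apply Rdiv_lt_0_compat; auto).
  assert (HL2 : 0 < L / l ^ 2)
    by (apply Rdiv_lt_0_compat; [auto | apply pow_lt; auto]).
  assert (Hpos : forall b r, 0 < b -> 0 <= K * b * exp (l * r)).
  { intros b r Hb. apply Rmult_le_pos; [|left; apply exp_pos].
    apply Rmult_le_pos; lra. }
  apply (picard_diff_le m c S a x y
           (fun s => K * (L / l ^ 2) * exp (l * s))
           (fun s => K * (L / l) * exp (l * s))
           (fun s => K * L * exp (l * s))); auto; try lra.
  - intros r Hr. auto_derive; auto. field; lra.
  - intros r Hr. auto_derive; auto. field; lra.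
  - intros r Hr. eapply Rle_trans; [apply root_cut_lipschitz; auto|].
    fold L. specialize (Hxy r Hr).
    replace (K * L * exp (l * r)) with (L * (K * exp (l * r))) by ring.
    apply Rmult_le_compat_l; [lra|auto].
Qed.

Lemma cut_solution_exists (m c S a : R) :
  0 < m -> 0 <= c -> 0 < S -> exists u v, cut_solution m c S a u v.
Proof.
  intros Hm Hc HS.
  set (L := / root_cut m m).
  assert (HL : 0 < L).
  { apply Rinv_0_lt_compat, sqrt_lt_R0. rewrite Rmax_left; lra. }
  set (l := 1 + 2 * L).
  assert (Hl : 0 < l) by (unfold l; lra).
  assert (HLl : L / l ^ 2 <= / 2).
  { apply Rmult_le_reg_r with (r := l ^ 2); [apply pow_lt; auto|].
    replace (L / l ^ 2 * l ^ 2) with L by (field; lra). unfold l; nra. }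
  set (w := fix w n := match n with
                       | O => fun _ => a
                       | Datatypes.S n => picard m c S a (w n) end).
  assert (Hw : forall n, continuous_on_segment S (w n)).
  { induction n as [|n IH].
    - intros x. apply continuous_const.
    - apply picard_continuous_on_segment; auto; lra. }
  set (B := Rabs (1 - root_cut m a)).
  assert (HB : 0 <= B) by apply Rabs_pos.
  assert (Hv : forall s, 0 <= s <= S ->
            Rabs (picard_velocity m c S (w O) s) <= B * s).
  { apply (damped_abs_le c S _ (fun _ => 1 - root_cut m a) (fun s => B * s)
             (fun _ => B)); auto.
    - intros s Hs. apply (picard_velocity_derive m c S (w O)); auto; lra.
    - intros s Hs. auto_derive; auto. ring.
    - intros; apply Rle_refl.
    - intros s Hs. apply Rmult_le_pos; lra.
    - rewrite picard_velocity_0, Rabs_R0. lra. }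
  assert (H0 : forall s, 0 <= s <= S ->
            Rabs (w 1%nat s - w O s) <= B * (s ^ 2 / 2)).
  { apply (abs_le_of_derive S (fun s => picard m c S a (w O) s - a)
             (picard_velocity m c S (w O)) _ (fun s => B * s)); auto.
    - intros s Hs. rewrite <- (Rminus_0_r (picard_velocity m c S (w O) s)).
      apply (is_derive_minus (picard m c S a (w O)) (fun _ => a)).
      + apply picard_derive; auto; lra.
      + apply (is_derive_const a).
    - intros s Hs. auto_derive; auto. field.
    - rewrite picard_0, Rminus_diag, Rabs_R0. lra. }
  assert (Hexp : forall s, 0 <= s -> 1 <= exp (l * s)).
  { intros s Hs. pose proof (exp_ineq1_le (l * s)). nra. }
  assert (Hstep : forall n s, 0 <= s <= S ->
            Rabs (w (n + 1)%nat s - w n s)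
              <= B * S ^ 2 * (/ 2) ^ n * exp (l * s)).
  { induction n as [|n IH]; intros s Hs.
    - eapply Rle_trans; [apply H0; auto|].
      specialize (Hexp s (proj1 Hs)).
      assert (HBs : B * (s ^ 2 / 2) <= B * S ^ 2)
        by (apply Rmult_le_compat_l; [auto | nra]).
      assert (0 <= B * S ^ 2) by (apply Rmult_le_pos; [auto | apply pow2_ge_0]).
      simpl ((/ 2) ^ 0). nra.
    - set (K := B * S ^ 2 * (/ 2) ^ n) in *.
      assert (HK : 0 <= K).
      { apply Rmult_le_pos; [|apply pow_le; lra].
        apply Rmult_le_pos; [auto | apply pow2_ge_0]. }
      pose proof (picard_contraction m c S a l K (w (n + 1)%nat) (w n) Hm Hc Hl
                    HK (Hw _) (Hw _) IH s Hs) as H.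
      fold L in H.
      replace (n + 1)%nat with (Datatypes.S n) in H by lia.
      replace (Datatypes.S n + 1)%nat with (Datatypes.S (Datatypes.S n)) by lia.
      eapply Rle_trans; [exact H|].
      apply Rmult_le_compat_r; [left; apply exp_pos|].
      unfold K. simpl ((/ 2) ^ Datatypes.S n). fold K.
      replace (B * S ^ 2 * (/ 2 * (/ 2) ^ n)) with (K * / 2) by (unfold K; ring).
      apply Rmult_le_compat_l; auto. }
  assert (HB' : 0 <= B * S ^ 2 * exp (l * S)).
  { apply Rmult_le_pos; [|left; apply exp_pos].
    apply Rmult_le_pos; [auto | apply pow2_ge_0]. }
  pose proof (geometric_cauchy S (B * S ^ 2 * exp (l * S)) w HB') as Hcauchy.
  assert (Hc' : forall eps, 0 < eps -> exists N, forall n k,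
            (N <= n)%nat -> (N <= k)%nat ->
            forall s, 0 <= s <= S -> Rabs (w n s - w k s) < eps).
  { apply Hcauchy. intros n s Hs. eapply Rle_trans; [apply Hstep; auto|].
    replace (B * S ^ 2 * exp (l * S) * (/ 2) ^ n)
      with (B * S ^ 2 * (/ 2) ^ n * exp (l * S)) by ring.
    apply Rmult_le_compat_l.
    - apply Rmult_le_pos; [|apply pow_le; lra].
      apply Rmult_le_pos; [auto | apply pow2_ge_0].
    - destruct (Req_dec s S) as [->|]; [lra|]. left; apply exp_increasing. nra. }
  apply (solution_of_approximations m c S a w); auto; try lra.
  intros eps Heps. destruct (Hc' eps Heps) as [N HN]. exists N.
  intros n Hn s Hs. apply (HN (Datatypes.S n) n); auto.
Qed.

(** The cut-off level is chosen such that the energy keeps the solution above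
    it. *)
Lemma solution_exists_pos (c S a : R) :
  0 < c -> 0 < S -> 0 < a <= 9 / 8 -> exists u v, cut_solution 0 c S a u v.
Proof.
  intros Hc HS Ha.
  assert (Hcs : 0 < c / (4 * S)) by (apply Rdiv_lt_0_compat; lra).
  set (m := Rmin (Rmin (a / 2) (1 / 2)) (c / (4 * S) * a ^ 2)).
  assert (H1 : m <= a / 2) by (eapply Rle_trans; [apply Rmin_l | apply Rmin_l]).
  assert (H2 : m <= 1 / 2) by (eapply Rle_trans; [apply Rmin_l | apply Rmin_r]).
  assert (H3 : m <= c / (4 * S) * a ^ 2) by apply Rmin_r.
  assert (Hm : 0 < m).
  { repeat apply Rmin_pos; try lra. apply Rmult_lt_0_compat; auto.
    apply pow_lt; lra. }
  destruct (cut_solution_exists m c S a Hm (Rlt_le _ _ Hc) HS) as (u & v & Hsol).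
  exists u, v.
  pose proof (cut_solution_ge_cut m c S a u v Hc HS ltac:(lra) (Rlt_le _ _ Hm)
                H1 H2 H3 Hsol) as Hge.
  destruct Hsol as (Hu0 & Hv0 & Hd). split; auto. split; auto.
  intros s Hs. destruct (Hd s Hs) as [Hu Hv]. split; auto.
  replace (root_cut 0 (u s)) with (root_cut m (u s)); auto.
  specialize (Hge s Hs). unfold root_cut. rewrite !Rmax_left; lra.
Qed.

(** The solution for [alpha = 0] is the limit of those for [alpha = 1/(n+1)];
    the Lipschitz estimate makes this sequence uniformly convergent. *)
Lemma solution_exists (c S alpha : R) :
  0 < c -> 0 < S -> 0 <= alpha <= 3 / 2 ->
  exists u v, cut_solution 0 c S (/ 2 * alpha ^ 2) u v.
Proof.
  intros Hc HS Hal. destruct (Req_dec alpha 0) as [->|Hne].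
  2:{ apply solution_exists_pos; auto. nra. }
  set (al := fun n => / INR (n + 1)).
  assert (Hn : forall n, 1 <= INR (n + 1)).
  { intros n. rewrite plus_INR. pose proof (pos_INR n). simpl. lra. }
  assert (Hal' : forall n, 0 < al n <= 1).
  { intros n. specialize (Hn n). unfold al. split.
    - apply Rinv_0_lt_compat; lra.
    - rewrite <- Rinv_1. apply Rinv_le_contravar; lra. }
  assert (Hsmall : forall eps, 0 < eps -> exists N, forall n, (N <= n)%nat ->
            al n < eps).
  { intros eps Heps. destruct (archimed_cor1 eps Heps) as [N [HN HN0]].
    exists N. intros n Hge. eapply Rle_lt_trans; [|exact HN].
    apply Rinv_le_contravar.
    - apply lt_0_INR; auto.
    - apply le_INR; lia. }
  destruct (lipschitz_dependence c S Hc HS) as (C & HC & Hlip).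
  assert (Hex : forall n, exists uv : (R -> R) * (R -> R),
            cut_solution 0 c S (/ 2 * al n ^ 2) (fst uv) (snd uv)).
  { intros n. destruct (solution_exists_pos c S (/ 2 * al n ^ 2) Hc HS)
      as (u & v & H).
    - specialize (Hal' n). nra.
    - exists (u, v). auto. }
  set (uv := fun n => epsilon (inhabits (fun x : R => x, fun x : R => x))
    (fun uv => cut_solution 0 c S (/ 2 * al n ^ 2) (fst uv) (snd uv))).
  assert (Huv : forall n,
            cut_solution 0 c S (/ 2 * al n ^ 2) (fst (uv n)) (snd (uv n))).
  { intros n. apply epsilon_spec; auto. }
  apply (solution_of_approximations 0 c S _ (fun n => fst (uv n))); try lra.
  - intros n. apply derivable_continuous_on_segment; [lra|].
    intros s Hs. exists (snd (uv n) s).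
    destruct (Huv n) as (_ & _ & Hd). apply (Hd s Hs).
  - intros eps Heps.
    destruct (Hsmall (eps / (C + 1))) as [N HN].
    { apply Rdiv_lt_0_compat; lra. }
    exists N. intros n k Hnn Hk s Hs.
    eapply Rle_lt_trans.
    { apply (Hlip (al n) (al k) _ (snd (uv n)) _ (snd (uv k))); auto.
      - specialize (Hal' n). lra.
      - specialize (Hal' k). lra. }
    assert (Hd : Rabs (al n - al k) < eps / (C + 1)).
    { pose proof (HN n Hnn). pose proof (HN k Hk).
      pose proof (Hal' n). pose proof (Hal' k).
      apply Rabs_lt_between. lra. }
    apply Rle_lt_trans with ((C + 1) * Rabs (al n - al k)).
    + pose proof (Rabs_pos (al n - al k)). lra.
    + apply Rmult_lt_compat_l with (r := C + 1) in Hd; [|lra].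
      replace ((C + 1) * (eps / (C + 1))) with eps in Hd by (field; lra). auto.
  - intros eps Heps. destruct (Hsmall eps Heps) as [N HN]. exists N.
    intros n Hnn s Hs.
    rewrite (cut_solution_picard 0 c S _ (/ 2 * 0 ^ 2) _ _ (Rle_refl _)
               (Rlt_le _ _ Hc) (Rlt_le _ _ HS) (Huv n) s Hs).
    specialize (HN n Hnn). specialize (Hal' n).
    apply Rabs_lt_between. nra.
Qed.

(** * One-sided and two-sided derivatives *)

(** The extension of [f] from [0, S] to the real line by its tangent lines at
    the endpoints, [g] being the derivative of [f]. It has two-sided derivatives
    at [0] and [S]. *)
Definition affine_extension (S : R) (f g : R -> R) (x : R) : R :=
  f (clamp S x) + g (clamp S x) * (x - clamp S x).

Lemma affine_extension_eq (S : R) (f g : R -> R) (s : R) :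
  0 <= s <= S -> affine_extension S f g s = f s.
Proof. intros Hs. unfold affine_extension. rewrite clamp_id by auto. ring. Qed.

Lemma affine_extension_derive (S : R) (f g : R -> R) (s : R) :
  0 < S -> 0 <= s <= S -> D_in f g (interval 0 S) s ->
  is_derive (affine_extension S f g) s (g s).
Proof.
  intros HS Hs Hd. apply is_derive_Reals. intros eps Heps.
  destruct (Hd eps Heps) as (d & Hd0 & Hd1).
  (* Below this distance, a point outside [0, S] can only lie beyond [s]
     itself, where the difference quotient is exactly [g s]. *)
  assert (Hdelta : exists e, 0 < e <= d /\ (s = 0 \/ e <= s) /\
                             (s = S \/ e <= S - s)).
  { destruct (Req_dec s 0) as [E|E].
    - exists (Rmin d S). split; [split; [apply Rmin_pos; lra | apply Rmin_l]|].
      split; [left; auto|right]. rewrite E, Rminus_0_r. apply Rmin_r.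
    - destruct (Req_dec s S) as [E'|E'].
      + exists (Rmin d s).
        split; [split; [apply Rmin_pos; lra | apply Rmin_l]|].
        split; [right; apply Rmin_r | left; auto].
      + exists (Rmin d (Rmin s (S - s))).
        split; [split; [repeat apply Rmin_pos; lra | apply Rmin_l]|].
        split; right; (eapply Rle_trans; [apply Rmin_r|]);
          [apply Rmin_l | apply Rmin_r]. }
  destruct Hdelta as (e & [He0 He1] & Hl & Hr).
  exists (mkposreal e He0). intros h Hh Hhe. simpl in Hhe.
  rewrite (affine_extension_eq S f g s Hs).
  assert (Hhe2 := Hhe). apply Rabs_lt_between in Hhe2.
  unfold affine_extension.
  destruct (Rlt_dec (s + h) 0) as [Hneg|Hneg].
  - assert (s = 0) by (destruct Hl; lra). subst s.
    replace (clamp S (0 + h)) with 0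
      by (unfold clamp, Rmax, Rmin; repeat destruct Rle_dec; lra).
    replace ((f 0 + g 0 * (0 + h - 0) - f 0) / h - g 0) with 0 by (field; auto).
    rewrite Rabs_R0; auto.
  - destruct (Rlt_dec S (s + h)) as [Hgt|Hgt].
    + assert (s = S) by (destruct Hr; lra). subst s.
      replace (clamp S (S + h)) with S
        by (unfold clamp, Rmax, Rmin; repeat destruct Rle_dec; lra).
      replace ((f S + g S * (S + h - S) - f S) / h - g S) with 0
        by (field; auto).
      rewrite Rabs_R0; auto.
    + rewrite clamp_id by lra.
      replace (f (s + h) + g (s + h) * (s + h - (s + h)) - f s)
        with (f (s + h) - f s) by ring.
      specialize (Hd1 (s + h)). simpl in Hd1. unfold Rdist in Hd1.
      replace (s + h - s) with h in Hd1 by ring.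
      apply Hd1. split; [split|].
      * unfold interval; lra.
      * lra.
      * lra.
Qed.

Lemma is_derive_D_in (f g : R -> R) (D : R -> Prop) (s : R) :
  is_derive f s (g s) -> D_in f g D s.
Proof.
  intros Hd. apply is_derive_Reals in Hd. intros eps Heps.
  destruct (Hd eps Heps) as [d Hdel].
  exists d. split; [apply cond_pos|]. intros x [[_ Hx] Hdist].
  simpl in *. unfold Rdist in *.
  specialize (Hdel (x - s) ltac:(lra) Hdist).
  replace (s + (x - s)) with x in Hdel by ring. exact Hdel.
Qed.

Lemma continuous_continue_in (f : R -> R) (D : R -> Prop) (s : R) :
  continuous f s -> continue_in f D s.
Proof.
  intros Hc eps Heps.
  apply (proj1 (filterlim_locally _ _)) with (eps := mkposreal eps Heps) in Hc.
  destruct Hc as [d Hd]. exists d. split; [apply cond_pos|].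
  intros x [_ Hdist]. apply (Hd x). exact Hdist.
Qed.

(** Every solution on [0, S] agrees there with one having two-sided
    derivatives. *)
Lemma cut_solution_of_is_solution (S beta omega alpha : R) (u : R -> R) :
  0 < S -> is_solution S beta omega alpha u ->
  exists U V, cut_solution 0 (beta / sqrt omega) S (/ 2 * alpha ^ 2) U V /\
    forall s, 0 <= s <= S -> U s = u s.
Proof.
  intros HS (u' & u'' & HC2 & Hpos & Hode & Hu0 & Hu'0).
  exists (affine_extension S u u'), (affine_extension S u' u'').
  split; [|intros s Hs; apply affine_extension_eq; auto].
  split; [rewrite affine_extension_eq by lra; auto|].
  split; [rewrite affine_extension_eq by lra; auto|].
  intros s Hs. destruct (HC2 s Hs) as (Hd & Hd' & _).
  rewrite !affine_extension_eq by auto. split.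
  - apply affine_extension_derive; auto.
  - replace (1 - beta / sqrt omega * u' s - root_cut 0 (u s)) with (u'' s).
    + apply affine_extension_derive; auto.
    + unfold root_cut. rewrite Rmax_left by (apply Hpos; auto).
      pose proof (Hode s Hs). lra.
Qed.

Lemma is_solution_of_cut_solution (S beta omega alpha : R) (u v : R -> R) :
  0 < S -> 0 < beta / sqrt omega -> 0 <= alpha <= 3 / 2 ->
  cut_solution 0 (beta / sqrt omega) S (/ 2 * alpha ^ 2) u v ->
  is_solution S beta omega alpha u.
Proof.
  intros HS Hc Hal Hsol.
  assert (Ha : 0 <= / 2 * alpha ^ 2 <= 9 / 8).
  { pose proof (pow_incr alpha (3 / 2) 2 Hal). pose proof (pow2_ge_0 alpha).
    lra. }
  pose proof (solution_ge0 _ S _ u v Hc HS Ha Hsol) as Hpos.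
  destruct Hsol as (Hu0 & Hv0 & Hd).
  exists v, (fun s => 1 - beta / sqrt omega * v s - root_cut 0 (u s)).
  split; [|split; [|split; [|split]]]; auto.
  - intros s Hs. destruct (Hd s Hs) as [Hu Hv]. split; [|split].
    + apply is_derive_D_in; auto.
    + apply is_derive_D_in; auto.
    + apply continuous_continue_in.
      assert (Hcu : continuous u s)
        by (apply (ex_derive_continuous u); exists (v s); auto).
      assert (Hcv : continuous v s)
        by (apply (ex_derive_continuous v); eexists; exact Hv).
      apply (continuous_minus (fun s => 1 - beta / sqrt omega * v s)
               (fun s => root_cut 0 (u s))).
      * apply (continuous_minus (fun _ => 1)
                 (fun s => beta / sqrt omega * v s)).
        -- apply continuous_const.
        -- apply (continuous_scal_r (beta / sqrt omega) v); auto.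
      * apply (continuous_comp u (root_cut 0)); auto.
        apply root_cut_continuous; lra.
  - intros s Hs. unfold root_cut. rewrite Rmax_left by (apply Hpos; auto). ring.
Qed.

(** * Well-posedness *)

Lemma max_norm_exists (S : R) (f : R -> R) : 0 < S ->
  (forall s, 0 <= s <= S -> continuous f s) -> exists m, is_max_norm S f m.
Proof.
  intros HS Hf.
  destruct (continuity_ab_maj (fun s => Rabs (f s)) 0 S) as [s0 [Hmax Hs0]].
  - lra.
  - intros s Hs. apply continuity_pt_filterlim.
    apply (continuous_comp f Rabs); [auto | apply continuous_Rabs].
  - exists (Rabs (f s0)). split; [exists s0; auto | exact Hmax].
Qed.

Lemma is_max_norm_ext (S : R) (f g : R -> R) (m : R) :
  (forall s, 0 <= s <= S -> f s = g s) -> is_max_norm S f m -> is_max_norm S g m.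
Proof.
  intros Hfg [(s & Hs & Hm) Hmax]. split.
  - exists s. rewrite <- Hfg by auto. auto.
  - intros r Hr. rewrite <- Hfg by auto. auto.
Qed.

Lemma unique_solution_exists (S beta omega alpha : R) :
  0 < S -> 0 < beta / sqrt omega -> 0 <= alpha <= 3 / 2 ->
  exists u : R -> R,
    is_unique_solution S beta omega alpha u /\
    (alpha = 0 -> forall s : R, 0 < s <= S -> 0 < u s) /\
    (0 < alpha -> forall s : R, 0 <= s <= S -> 0 < u s) /\
    (alpha < 3 / 2 -> forall s : R, 0 <= s <= S -> u s < 9 / 8) /\
    (forall s : R, 0 <= s <= S -> u s <= 9 / 8).
Proof.
  intros HS Hc Hal.
  destruct (solution_exists _ S alpha Hc HS Hal) as (u & v & Hsol).
  assert (Ha : 0 <= / 2 * alpha ^ 2 <= 9 / 8).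
  { pose proof (pow_incr alpha (3 / 2) 2 Hal). pose proof (pow2_ge_0 alpha).
    lra. }
  destruct (uniform_lower_bound _ S Hc HS) as (q & Hq & Hlow).
  specialize (Hlow alpha u v Hal Hsol).
  assert (Hpos : forall s, 0 <= s <= S -> 0 < alpha + s -> 0 < u s).
  { intros s Hs H. specialize (Hlow s Hs). pose proof (pow_lt _ 2 H). nra. }
  pose proof (solution_upper_bound _ S _ u v Hc HS Ha Hsol) as Hup.
  exists u. split; [split|split; [|split; [|split]]].
  - eapply is_solution_of_cut_solution; eauto.
  - intros u2 Hu2 s Hs.
    destruct (cut_solution_of_is_solution S beta omega alpha u2 HS Hu2)
      as (U & V & HUV & Heq).
    rewrite <- Heq by auto.
    destruct (lipschitz_dependence _ S Hc HS) as (C & HC & Hlip).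
    pose proof (Hlip alpha alpha U V u v Hal Hal HUV Hsol s Hs) as H.
    rewrite Rminus_diag, Rabs_R0, Rmult_0_r in H.
    apply Rabs_le_between in H. lra.
  - intros H0 s Hs. apply Hpos; lra.
  - intros H0 s Hs. apply Hpos; lra.
  - intros H0 s Hs. apply (Hup s Hs). nra.
  - intros s Hs. apply (Hup s Hs).
Qed.

Lemma solutions_continuous_in_data (S beta omega : R) (u : R -> R -> R) :
  0 < S -> 0 < beta / sqrt omega ->
  (forall alpha, interval 0 (3 / 2) alpha ->
     is_solution S beta omega alpha (u alpha)) ->
  forall alpha0, interval 0 (3 / 2) alpha0 -> continuous_in_data_at S u alpha0.
Proof.
  intros HS Hc Hu alpha0 Hal0.
  destruct (cut_solution_of_is_solution S beta omega alpha0 _ HS (Hu _ Hal0))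
    as (U0 & V0 & HUV0 & Heq0).
  destruct (lipschitz_dependence _ S Hc HS) as (C & HC & Hlip).
  set (d := fun alpha => epsilon (inhabits 0)
              (is_max_norm S (fun s => u alpha s - u alpha0 s))).
  assert (Hd : forall alpha, interval 0 (3 / 2) alpha ->
            is_max_norm S (fun s => u alpha s - u alpha0 s) (d alpha) /\
            Rabs (d alpha) <= C * Rabs (alpha - alpha0)).
  { intros alpha Hal.
    destruct (cut_solution_of_is_solution S beta omega alpha _ HS (Hu _ Hal))
      as (U & V & HUV & Heq).
    assert (Hmax : is_max_norm S (fun s => u alpha s - u alpha0 s) (d alpha)).
    { apply epsilon_spec.
      destruct (max_norm_exists S (fun s => U s - U0 s) HS) as [m Hm].
      - intros s Hs. apply (continuous_minus U U0).
        + apply (ex_derive_continuous U). exists (V s).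
          destruct HUV as (_ & _ & Hd). apply (Hd s Hs).
        + apply (ex_derive_continuous U0). exists (V0 s).
          destruct HUV0 as (_ & _ & Hd). apply (Hd s Hs).
      - exists m. revert Hm. apply is_max_norm_ext.
        intros s Hs. rewrite Heq, Heq0 by auto. reflexivity. }
    split; auto. destruct Hmax as [(s & Hs & <-) _].
    rewrite Rabs_Rabsolu, <- Heq, <- Heq0 by auto.
    apply (Hlip alpha alpha0 U V U0 V0); auto. }
  exists d. split; [intros alpha Hal; apply Hd; auto|].
  intros eps Heps. exists (eps / (C + 1)).
  split; [apply Rdiv_lt_0_compat; lra|].
  intros alpha [Hal Hdist]. simpl in *. unfold Rdist in *.
  rewrite Rminus_0_r. destruct (Hd alpha Hal) as [_ Hle].
  eapply Rle_lt_trans; [exact Hle|].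
  apply Rle_lt_trans with ((C + 1) * Rabs (alpha - alpha0)).
  - pose proof (Rabs_pos (alpha - alpha0)). lra.
  - apply Rmult_lt_compat_l with (r := C + 1) in Hdist; [|lra].
    replace ((C + 1) * (eps / (C + 1))) with eps in Hdist by (field; lra). auto.
Qed.

Theorem theorem4p2 (S beta omega : R)
    (hS : 0 < S) (hbeta : 0 < beta) (homega : 0 < omega) :
  (forall alpha : R, interval 0 (3 / 2) alpha ->
     exists u : R -> R,
       is_unique_solution S beta omega alpha u /\
       (alpha = 0 -> forall s : R, 0 < s <= S -> 0 < u s) /\
       (0 < alpha -> forall s : R, 0 <= s <= S -> 0 < u s) /\
       (alpha < 3 / 2 -> forall s : R, 0 <= s <= S -> u s < 9 / 8) /\
       (forall s : R, 0 <= s <= S -> u s <= 9 / 8)) /\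
  (forall u : R -> R -> R,
     (forall alpha : R, interval 0 (3 / 2) alpha ->
        is_solution S beta omega alpha (u alpha)) ->
     forall alpha0 : R, interval 0 (3 / 2) alpha0 ->
       continuous_in_data_at S u alpha0) /\
  (forall alpha : R, interval 0 (3 / 2) alpha ->
     hadamard_well_posed S beta omega alpha).
Proof.
  assert (Hc : 0 < beta / sqrt omega)
    by (apply Rdiv_lt_0_compat; auto; apply sqrt_lt_R0; auto).
  split; [|split].
  - intros alpha Hal. apply unique_solution_exists; auto.
  - intros u Hu. apply (solutions_continuous_in_data S beta omega u); auto.
  - intros alpha0 Hal0.
    set (u := fun alpha => epsilon (inhabits (fun x : R => x))
                (is_unique_solution S beta omega alpha)).
    assert (Hu : forall alpha, interval 0 (3 / 2) alpha ->
              is_unique_solution S beta omega alpha (u alpha)).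
    { intros alpha Hal. apply epsilon_spec.
      destruct (unique_solution_exists S beta omega alpha hS Hc Hal)
        as (w & Hw & _). exists w; auto. }
    exists u. split; auto.
    apply (solutions_continuous_in_data S beta omega u); auto.
    intros alpha Hal. apply Hu; auto.
Qed.
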